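(* Let $n\ge2$ and let $P(z)=a_1z+\dots+a_nz^n$ with real coefficients, $a_1>0$ and $a_n\neq0$ (so $n=\deg P$). Then the Jacobian of the complex moment mapping $\mu$ satisfies $$J(P)=\det d\mu(P)=2^{-\frac{n(n-3)}{2}}\,a_1^{\frac{n(n-1)}{2}}\,P'(1)\,P'(-1)\,\Delta(\widetilde{P'}),$$ where $\widetilde{P'}$ is the Möbius transformation of $P'$ and $\Delta(\widetilde{P'})$ is its Hurwitz determinant.
   Context: Let $\mathbb{D}$ be the open unit disk in $\mathbb{C}$. For a polynomial $P(z)=a_1z+\dots+a_nz^n$ and an integer $k\ge0$, the complex moment is $$M_k(P)=\frac{i}{2\pi}\iint_{\mathbb{D}}P(z)^k|P'(z)|^2\,dz\wedge d\overline{z}=\frac1\pi\iint_{\mathbb{D}}P(z)^k|P'(z)|^2\,dx\,dy .$$ For real coefficients, $M_k(P)$ is a real polynomial function of $(a_1,\dots,a_n)$. The moment mapping is $\mu(P)=(M_0(P),\dots,M_{n-1}(P))$, regarded as a function of $(a_1,\dots,a_n)$, and its Jacobian is $$J(P)=\det d\mu(P)=\det\left[\frac{\partial M_k(P)}{\partial a_\nu}\right]_{0\le k\le n-1,\ 1\le\nu\le n}.$$ Möbius transformation: for a polynomial $R$ of degree $m\geq 1$, put $\widetilde R(z)=(z+1)^mR\left(\frac{z-1}{z+1}\right)=\widetilde r_0+\widetilde r_1z+\dots+\widetilde r_mz^m$. Here $R=P'$ and $m=n-1$. Hurwitz determinant: for $Q(z)=q_0+q_1z+\dots+q_mz^m$,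 set $q_k=0$ for $k<0$ and $k>m$; the Hurwitz matrix is the $m\times m$ matrix with entries $\mathcal{G}_{ij}(Q)=q_{m+i-2j}$, $1\le i,j\le m$, and $\Delta(Q)$ is its leading principal minor of order $m-1$ (equal to $1$ if $m=1$). For $Q=\widetilde{R}$ the Hurwitz matrix is formed with the same $m=\deg R$ and the coefficients $\widetilde r_0,\dots,\widetilde r_m$ (even if $\widetilde r_m=0$). *)

(* Defs.v *)
From HB Require Import structures.
From mathcomp Require Import all_boot all_order all_algebra.
From mathcomp Require Import complex.
From mathcomp Require Import all_classical all_reals all_analysis.

Set Implicit Arguments.
Unset Strict Implicit.
Unset Printing Implicit Defensive.

Import Order.TTheory GRing.Theory Num.Theory.
Import numFieldNormedType.Exports.

Local Open Scope classical_set_scope.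
Local Open Scope ring_scope.
Local Open Scope complex_scope.

Section Moments.
Variable R : realType.

Definition unit_disk : set (R * R) := [set p | `|p.1 +i* p.2| < 1].

Definition lebesgue2 := ((@lebesgue_measure R) \x (@lebesgue_measure R))%E.

Definition cintegral (D : set (R * R)) (f : R[i] -> R[i]) : R[i] :=
  (\int[lebesgue2]_(p in D) complex.Re (f (p.1 +i* p.2)))%R +i*
  (\int[lebesgue2]_(p in D) complex.Im (f (p.1 +i* p.2)))%R.

Definition moment (k : nat) (P : {poly R[i]}) : R[i] :=
  ((@pi R)^-1)%:C * cintegral unit_disk (fun z => P.[z] ^+ k * `|P^`().[z]| ^+ 2).

(* The column index j : 'I_n stands for nu = j + 1: a 0 j is a_(j+1). *)
Definition poly_of_coefs n (a : 'rV[R]_n) : {poly R} :=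
  \sum_(j < n) a 0 j *: 'X^(j.+1).

Definition moment_map n (a : 'rV[R]_n) : 'rV[R[i]]_n :=
  \row_(k < n) moment k (map_poly (real_complex R) (poly_of_coefs a)).

Definition cpartial n (f : 'rV[R]_n -> R[i]) (j : 'I_n) (a : 'rV[R]_n) : R[i] :=
  'D_(delta_mx 0 j) (fun b => complex.Re (f b)) a +i*
  'D_(delta_mx 0 j) (fun b => complex.Im (f b)) a.

Definition moment_jacobian n (a : 'rV[R]_n) : R[i] :=
  \det (\matrix_(k < n, j < n) cpartial (fun b => moment_map b 0 k) j a).

End Moments.

Section MobiusHurwitz.
Variable F : fieldType.

(* (z + 1)^m Q((z - 1) / (z + 1)) with denominators cleared, m = deg Q;
   see mobius_horner. *)
Definition mobius (Q : {poly F}) : {poly F} :=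
  let m := (size Q).-1 in
  \sum_(j < m.+1) Q`_j *: (('X - 1) ^+ j * ('X + 1) ^+ (m - j)).

Lemma mobius_horner (Q : {poly F}) (z : F) : z + 1 != 0 ->
  (mobius Q).[z] = (z + 1) ^+ (size Q).-1 * Q.[(z - 1) / (z + 1)].
Proof.
move=> z1; rewrite /mobius (@horner_coef_wide _ (size Q).-1.+1 Q); last exact: leqSpred.
rewrite horner_sum mulr_sumr; apply: eq_bigr => j _.
rewrite hornerZ hornerM !horner_exp !hornerD hornerN hornerX -polyC1 !hornerC [RHS]mulrCA.
congr (_ * _); rewrite expr_div_n expfB_cond ?(negPf z1) ?add0n -1?ltnS //.
by rewrite mulrCA.
Qed.

Definition coefz (Q : {poly F}) (k : int) : F :=
  if k is Posz k' then Q`_k' else 0.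

(* Entry (i, j) is q_(m + i - 2 j) for 1-based i and j.  The size m is a
   separate argument because m may exceed the degree of Q. *)
Definition hurwitz_mx (m : nat) (Q : {poly F}) : 'M[F]_m :=
  \matrix_(i < m, j < m) coefz Q (m%:Z + i.+1%:Z - 2 * j.+1%:Z).

(* Leading principal minor of order m - 1; for m = 1 the empty determinant 1. *)
Definition hurwitz_det (m : nat) (Q : {poly F}) : F :=
  \det (mxsub (widen_ord (leq_pred m)) (widen_ord (leq_pred m)) (hurwitz_mx m Q)).

End MobiusHurwitz.

(* Main.v *)
Require Import Defs.
From HB Require Import structures.
From mathcomp Require Import all_boot all_order all_algebra.
From mathcomp Require Import perm complex.
From mathcomp Require Import all_classical all_reals all_analysis.
From mathcomp Require Import measurable_realfun.
From mathcomp Require Import ring lra zify.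

(** Let N = n - 1 and R = P'.  Why the Jacobian factors as it does:

    Moments.  On the disk the functions z^p (conj z)^q integrate to
    [p = q] pi / (p + 1), so that
      M_k(P) = 1/(k+1) sum_j R_j [z^(j+1)] P^(k+1)
    (moment_real_poly).  Equivalently M_k is, up to the factor 1/(k+1), the
    constant term of P(z)^(k+1) z^-1 R(1/z).  Differentiating that constant
    term, and moving the operator z d/dz from one factor to the other, gives
      dM_k / da_(i+1) = sum_m [z^m] P^k (R_(i+m) + R_(i-m))
    (real_moment_derive_Xn).  The Jacobian matrix is therefore the coefficient
    matrix of 1, P, ..., P^N, which is triangular with diagonal entries a_1^k
    and accounts for the power of a_1, times the Hankel-plus-Toeplitz matrix
    fold_mx of R.

    The determinant of fold_mx.  It represents the map
      u |-> u(z) R(1/z) + u(1/z) R(z)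
    from polynomials of degree at most N to symmetric Laurent polynomials.
    Under z = (w - 1) / (w + 1), inversion of z becomes w |-> -w, and the map
    becomes u |-> u(w) Q(-w) + u(-w) Q(w), where Q is the Moebius transform of
    R (cayley_symmetrize).  On the monomials w^k it has the coefficients
    2 (-1)^k q_(2s-k): these form the Hurwitz matrix of Q bordered by one row
    and column with corner q_0 = R(-1) and another with corner q_N = R(1)
    (det_bordered_hurwitz).  The two changes of basis do not depend on R, and
    shifting the variable makes their matrices triangular; their determinants
    are signed powers of 2 (det_cayley, det_sym_cayley).

    Integrals over the disk.  Since (1 - |z|^2) z^p (conj z)^q vanishes on the
    unit circle, its x- and y-derivatives have integral 0 over the disk, by
    Fubini and the fundamental theorem of calculus on each chord.  The two
    resulting recurrences reduce all the integrals to the area of the disk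
    (diskint_zmon). *)

Set Implicit Arguments.
Unset Strict Implicit.
Unset Printing Implicit Defensive.

Import Order.TTheory GRing.Theory Num.Theory.
Local Open Scope ring_scope.
Local Open Scope complex_scope.

(** * Coefficient matrices of families of polynomials *)

Section CoefMatrices.
Variable F : fieldType.
Implicit Types (p q r : {poly F}) (N : nat).

Definition coef_mx N (p : nat -> {poly F}) : 'M[F]_N.+1 :=
  \matrix_(i, j) (p i)`_j.

Lemma coef_mx_comp N (p : nat -> {poly F}) q :
    (forall i, (i <= N)%N -> (size (p i) <= N.+1)%N) ->
  coef_mx N (fun i => p i \Po q) = coef_mx N p *m coef_mx N (fun k => q ^+ k).
Proof.
move=> sp; apply/matrixP => i j; rewrite !mxE comp_polyE.
rewrite (big_ord_widen N.+1 (fun k => (p i)`_k *: q ^+ k)); last first.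
  by apply: sp; rewrite -ltnS.
rewrite coef_sum big_mkcond; apply: eq_bigr => k _; rewrite !mxE.
by case: ltnP => [_|/leq_sizeP/(_ _ (leqnn _)) ->]; rewrite ?coefZ ?mul0r.
Qed.

(** The matrix of a shift of the variable is unitriangular: substituting 'X + c
    in all polynomials of a family does not change the determinant of their
    coefficient matrix. *)
Lemma det_coef_mx_shift N c : \det (coef_mx N (fun k => ('X + c%:P) ^+ k)) = 1.
Proof.
have sX k : size (('X + c%:P) ^+ k : {poly F}) = k.+1.
  by rewrite -[c]opprK polyCN size_exp_XsubC.
rewrite det_trig; last first.
  by apply/is_trig_mxP => i j ij; rewrite mxE nth_default ?sX.
apply: big1 => i _; rewrite mxE.
have /monicP : ('X + c%:P : {poly F}) ^+ i \is monic.
  by rewrite -[c]opprK polyCN monic_exp ?monicXsubC.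
by rewrite lead_coefE sX.
Qed.

Definition rev_perm n : {perm 'I_n} := perm (@rev_ord_inj n).

Lemma det_row_rev n (M : 'M[F]_n) :
  \det (\matrix_(i, j) M (rev_ord i) j) = (-1) ^+ rev_perm n * \det M.
Proof.
have -> : \matrix_(i, j) M (rev_ord i) j = row_perm (rev_perm n) M.
  by apply/matrixP => i j; rewrite !mxE permE.
by rewrite row_permE det_mulmx det_perm.
Qed.

Lemma det_rev n (M : 'M[F]_n) :
  \det (\matrix_(i, j) M (rev_ord i) (rev_ord j)) = \det M.
Proof.
have -> : \matrix_(i, j) M (rev_ord i) (rev_ord j) =
    \matrix_(i, j) (\matrix_(i, j) M i (rev_ord j)) (rev_ord i) j.
  by apply/matrixP => i j; rewrite !mxE.
rewrite det_row_rev -det_tr.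
have -> : (\matrix_(i, j) M i (rev_ord j))^T = \matrix_(i, j) M^T (rev_ord i) j.
  by apply/matrixP => i j; rewrite !mxE.
by rewrite det_row_rev det_tr mulrA -signr_addb addbb mul1r.
Qed.

(** After shifting c to the origin, the i-th polynomial starts at degree N - i,
    with coefficient (g i).[c]; so the matrix is triangular once its rows are
    reversed. *)
Lemma det_coef_mx_XsubC N c (g : nat -> {poly F}) :
    (forall i, (i <= N)%N -> (size (g i) <= i.+1)%N) ->
  \det (coef_mx N (fun i => ('X - c%:P) ^+ (N - i) * g i)) =
  (-1) ^+ rev_perm N.+1 * \prod_(i < N.+1) (g i).[c].
Proof.
move=> sg.
have sp i : (i <= N)%N -> (size (('X - c%:P) ^+ (N - i) * g i)%R <= N.+1)%N.
  move=> iN; have := size_polyMleq (('X - c%:P) ^+ (N - i)) (g i).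
  rewrite size_exp_XsubC; have := sg _ iN; move: (size _) (size _) => u v; lia.
rewrite -[LHS]mulr1 -[X in _ * X = _](det_coef_mx_shift N c) -det_mulmx
  -coef_mx_comp //.
have -> : coef_mx N (fun i => (('X - c%:P) ^+ (N - i) * g i) \Po ('X + c%:P)) =
    \matrix_(i, j) (\matrix_(i < N.+1, j < N.+1)
        ('X^i * (g (N - i)%N \Po ('X + c%:P)))`_j) (rev_ord i) j.
  apply/matrixP => i j; rewrite !mxE.
  rewrite rmorphM rmorphXn rmorphB /= comp_polyX comp_polyC addrK.
  by rewrite subSS subKn // -ltnS.
rewrite det_row_rev; congr (_ * _).
rewrite -det_tr det_trig; last first.
  by apply/is_trig_mxP => i j ij; rewrite !mxE coefXnM ij.
rewrite (reindex_inj rev_ord_inj) /=; apply: eq_bigr => i _.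
rewrite !mxE coefXnM ltnn subnn ?subSS subKn -1?ltnS // -horner_coef0 horner_comp.
by rewrite hornerD hornerX hornerC add0r.
Qed.

End CoefMatrices.

(** * The Cayley substitution and the folded matrix *)

Section Fold.
Variable F : fieldType.
Implicit Types (p q r : {poly F}) (N : nat).

(** With r`_k = 0 outside the support, entry (m, i) is r`_(i + m) + r`_(i - m):
    the multiplication by 'X^m avoids the truncated subtraction i - m.  This is
    the coefficient of z^m in z^i r(1/z) + z^-i r(z). *)
Definition fold_mx N r : 'M[F]_N.+1 :=
  \matrix_(m, i) (r`_(i + m) + ('X^m * r)`_i).

(** Each term r`_j contributes twice, once through the indices i - j and once
    through j - i; grouping by the distance m = |i - j| gives the left-hand
    side.  At m = 0 the bracket has a single term, since the matrix entry
    r`_i + r`_i already counts j = i twice. *)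
Lemma sum_fold N r (u : nat -> {poly F}) (i : nat) :
    (i <= N)%N -> (size r <= N.+1)%N ->
  \sum_(m < N.+1) (r`_(i + m) + ('X^m * r)`_i) *:
     (u (N + m)%N + u (N - m)%N *+ (0 < m)) =
  \sum_(j < N.+1) r`_j *: (u (N + i - j)%N + u (N + j - i)%N).
Proof.
move=> iN sr.
pose e m := u (N + m)%N + u (N - m)%N *+ (0 < m).
have pick c : (c <= N)%N ->
    \sum_(m < N.+1) (m == c :> nat)%:R *: e m = e c.
  move=> cN; have cN' : (c < N.+1)%N by [].
  rewrite (bigD1 (Ordinal cN')) //= eqxx scale1r big1 ?addr0 // => m.
  by rewrite -val_eqE /= => /negPf ->; rewrite scale0r.
have coefE k : r`_k = \sum_(j < N.+1) (j == k :> nat)%:R * r`_j.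
  case: (ltnP k N.+1) => kN.
    rewrite (bigD1 (Ordinal kN)) //= eqxx mul1r big1 ?addr0 // => m.
    by rewrite -val_eqE /= => /negPf ->; rewrite mul0r.
  rewrite (nth_default 0) ?(leq_trans sr) // big1 // => j _.
  by rewrite (_ : (_ == _) = false) ?mul0r //; apply/negP; case: j => j /=; lia.
have coefE' (m : nat) : ('X^m * r)`_i = \sum_(j < N.+1) (j + m == i)%N%:R * r`_j.
  rewrite coefXnM; case: ltnP => im.
    by rewrite big1 // => j _; rewrite (_ : (_ == _) = false) ?mul0r //; lia.
  rewrite coefE; apply: eq_bigr => j _; congr (_%:R * _); lia.
transitivity (\sum_(m < N.+1) \sum_(j < N.+1)
    r`_j *: ((j == i + m :> nat)%:R *: e m + (j + m == i)%N%:R *: e m)).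
  apply: eq_bigr => m _; rewrite coefE' [r`_(i + m)]coefE -big_split scaler_suml.
  by apply: eq_bigr => j _; rewrite /= -scalerDl scalerA -mulrDl mulrC.
rewrite exchange_big; apply: eq_bigr => j _; rewrite -scaler_sumr; congr (_ *: _).
rewrite big_split /=.
have -> : \sum_(m < N.+1) (j == i + m :> nat)%:R *: e m =
          if (i <= j)%N then e (j - i)%N else 0.
  case: leqP => ij.
    rewrite -pick; last by case: j ij => j /=; lia.
    by apply: eq_bigr => m _; congr (_%:R *: _); lia.
  by apply: big1 => m _; rewrite (_ : (_ == _) = false) ?scale0r //; lia.
have -> : \sum_(m < N.+1) (j + m == i)%N%:R *: e m =
          if (j <= i)%N then e (i - j)%N else 0.
  case: leqP => ij.
    rewrite -pick; last lia.
    by apply: eq_bigr => m _; congr (_%:R *: _); lia.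
  by apply: big1 => m _; rewrite (_ : (_ == _) = false) ?scale0r //; lia.
have jN : (j <= N)%N by rewrite -ltnS.
rewrite /e; case: (ltngtP i j) => ij.
- rewrite addr0 subn_gt0 ij mulr1n addrC; congr (u _ + u _); lia.
- rewrite add0r subn_gt0 ij mulr1n; congr (u _ + u _); lia.
- by rewrite -ij !subnn addn0 subn0 !mulr0n !addr0 addnK.
Qed.

(** The image of z^k under z = (w - 1) / (w + 1), with denominators cleared in
    degree N. *)
Definition cayley N k : {poly F} := ('X - 1) ^+ k * ('X + 1) ^+ (N - k).

(** The Moebius transform with the degree bound N as a parameter: this makes it
    linear in r. *)
Definition mobius_upto N r : {poly F} := \sum_(j < N.+1) r`_j *: cayley N j.

Lemma size_cayley N k : (k <= N)%N -> (size (cayley N k) <= N.+1)%N.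
Proof.
move=> kN; have := size_polyMleq (('X - 1) ^+ k) (('X + 1) ^+ (N - k) : {poly F}).
have -> : 'X - 1 = 'X - 1%:P :> {poly F} by [].
have E : 'X + 1 = 'X - (-1)%:P :> {poly F} by rewrite polyCN opprK.
by rewrite /cayley E !size_exp_XsubC => /leq_trans; apply; lia.
Qed.

Lemma size_mobius_upto N r : (size (mobius_upto N r) <= N.+1)%N.
Proof.
apply: (leq_trans (size_sum _ _ _)); apply/bigmax_leqP => j _.
by apply: (leq_trans (size_scale_leq _ _)); rewrite size_cayley // -ltnS.
Qed.

(** The inversion of z corresponds to the sign change of w. *)
Lemma cayley_opp N k : (k <= N)%N -> cayley N k \Po (- 'X) =
  (-1) ^+ N * cayley N (N - k).
Proof.
move=> kN; rewrite /cayley subKn //.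
rewrite rmorphM !rmorphXn !rmorphD !rmorphN rmorph1 /= comp_polyX.
have -> : - 'X - 1 = - ('X + 1) :> {poly F} by rewrite opprD.
have -> : - 'X + 1 = - ('X - 1) :> {poly F} by rewrite opprB addrC.
rewrite (exprNn ('X + 1)) (exprNn ('X - 1)) mulrACA -exprD subnKC //.
by congr (_ * _); rewrite mulrC.
Qed.

Lemma cayleyM N i j : (i <= N)%N -> (j <= N)%N ->
  cayley N i * cayley N j = cayley (N + N) (i + j).
Proof.
move=> iN jN; rewrite /cayley mulrACA -!exprD; congr (_ * _ ^+ _); lia.
Qed.

Definition cayley2 N k := cayley (N + N) k.

(** The image of z^m + z^-m (of 1, if m = 0) under z = (w - 1) / (w + 1), with
    denominators cleared in degree N + N. *)
Definition sym_cayley N m := cayley2 N (N + m) + cayley2 N (N - m) *+ (0 < m).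

Lemma coef_comp_opp p i : (p \Po (- 'X))`_i = (-1) ^+ i * p`_i.
Proof.
rewrite comp_polyE.
have -> : \sum_(k < size p) p`_k *: (- 'X) ^+ k =
          \poly_(k < size p) ((-1) ^+ k * p`_k).
  rewrite poly_def; apply: eq_bigr => k _.
  by rewrite -scaleN1r exprZn scalerA mulrC.
by rewrite coef_poly; case: ltnP => // /(nth_default 0) ->; rewrite mulr0.
Qed.

(** Entry (k, s) is p`_(2 s - k): a Hurwitz matrix with its rows and columns
    in reverse order, enlarged by a border. *)
Definition bordered_hurwitz N p : 'M[F]_N.+1 := \matrix_(k, s) ('X^k * p)`_(s.*2).

(** The map u |-> u(z) r(1/z) + u(1/z) r(z), evaluated on z^i and written in
    the variable w. *)
Lemma cayley_symmetrize N r (i : nat) : (i <= N)%N -> (size r <= N.+1)%N ->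
  cayley N i * (mobius_upto N r \Po (- 'X)) + (cayley N i \Po (- 'X)) *
    mobius_upto N r =
  (-1) ^+ N * \sum_(m < N.+1) (r`_(i + m) + ('X^m * r)`_i) *: sym_cayley N m.
Proof.
move=> iN sr; rewrite sum_fold // /mobius_upto.
rewrite rmorph_sum /= !mulr_sumr -big_split; apply: eq_bigr => j _ /=.
have jN : (j <= N)%N by rewrite -ltnS.
rewrite comp_polyZ !cayley_opp //.
have -> : cayley N i * (r`_j *: ((-1) ^+ N * cayley N (N - j))) =
          (-1) ^+ N * (r`_j *: cayley2 N (N + i - j)).
  rewrite -!scalerAr mulrCA cayleyM ?leq_subr //; congr (_ *: (_ * cayley _ _)); lia.
have -> : (-1) ^+ N * cayley N (N - i) * (r`_j *: cayley N j) =
          (-1) ^+ N * (r`_j *: cayley2 N (N + j - i)).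
  rewrite -!scalerAr -mulrA cayleyM ?leq_subr //; congr (_ *: (_ * cayley _ _)); lia.
by rewrite -mulrDr -scalerDr.
Qed.

(** The two products are exchanged by w |-> -w, so they have the same even
    part. *)
Lemma coef_add_opp p u s :
  (u * (p \Po (- 'X)) + (u \Po (- 'X)) * p)`_(s.*2) = (u * (p \Po (- 'X)))`_(s.*2) *+ 2.
Proof.
rewrite coefD mulr2n; congr (_ + _).
have -> : (u \Po (- 'X)) * p = (u * (p \Po (- 'X))) \Po (- 'X).
  by rewrite rmorphM /= -comp_polyA rmorphN /= comp_polyX opprK comp_polyXr.
by rewrite coef_comp_opp -signr_odd odd_double mul1r.
Qed.

(** The even coefficients of cayley_symmetrize as an identity of matrices: the
    outer factors on either side are changes of basis. *)
Lemma cayley_mx_fold N r : (size r <= N.+1)%N ->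
  coef_mx N (cayley N) *m (\matrix_(k, s) ((-1) ^+ k *+ 2 *
    bordered_hurwitz N (mobius_upto N r) k s)) =
  (-1) ^+ N *: ((fold_mx N r)^T *m coef_mx N (fun m => even_poly (sym_cayley N m))).
Proof.
move=> sr; apply/matrixP => i s.
have iN : (i <= N)%N by rewrite -ltnS.
have uE : cayley N i = \sum_(k < N.+1) (cayley N i)`_k *: 'X^k.
  rewrite -(poly_def N.+1 (fun k => (cayley N i)`_k)); apply/polyP => k.
  rewrite coef_poly; case: ltnP => // /(leq_trans (size_cayley iN)).
  by move/(nth_default 0).
transitivity ((cayley N i * (mobius_upto N r \Po (- 'X)))`_(s.*2) *+ 2).
  rewrite {1}uE mulr_suml coef_sum mxE -sumrMnl.
  apply: eq_bigr => k _; rewrite !mxE -scalerAl coefZ -mulrnAr; congr (_ * _).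
  rewrite !coefXnM; case: ltnP => ks; first by rewrite mulr0 mul0rn.
  rewrite coef_comp_opp -mulrnAl; congr (_ *+ 2 * _).
  by rewrite -[RHS]signr_odd oddB // odd_double signr_odd.
rewrite -coef_add_opp cayley_symmetrize // -(rmorph_sign polyC) coefCM mxE mxE coef_sum.
by congr (_ * _); apply: eq_bigr => m _; rewrite !mxE coefZ coef_even_poly.
Qed.

End Fold.

(** * Determinants of the changes of basis and of the bordered Hurwitz matrix *)

Section Dets.
Variable F : fieldType.
Implicit Types (p q r : {poly F}) (N : nat).

Lemma det_cayley N : \det (coef_mx N (cayley F N)) =
  (-1) ^+ rev_perm N.+1 * \prod_(i < N.+1) (-2) ^+ i.
Proof.
have -> : coef_mx N (cayley F N) =
    coef_mx N (fun i => ('X - (-1)%:P) ^+ (N - i) * ('X - 1%:P) ^+ i).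
  by apply/matrixP => i j; rewrite !mxE /cayley mulrC polyCN opprK.
rewrite (det_coef_mx_XsubC (-1) (g := fun i => ('X - 1%:P) ^+ i)).
  congr (_ * _); apply: eq_bigr => i _; rewrite horner_exp hornerXsubC.
  by congr (_ ^+ _); rewrite -opprD.
by move=> i _; rewrite size_exp_XsubC.
Qed.

Lemma horner_even_poly1 p : (even_poly p).[1] *+ 2 = p.[1] + p.[-1].
Proof.
rewrite -{2 3}(poly_even_odd p) !hornerD !hornerM !hornerX !horner_comp.
by rewrite !hornerXn expr1n sqrrN expr1n mulr1 mulrN1 addrACA subrr addr0 mulr2n.
Qed.

Lemma even_polyM_comp p q : even_poly ((p \Po 'X^2) * q) = p * even_poly q.
Proof.
elim/poly_ind: p => [|p c IH]; first by rewrite comp_poly0 !mul0r even_polyC.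
rewrite comp_polyD comp_polyM comp_polyX comp_polyC !mulrDl even_polyD.
rewrite !mul_polyC even_polyZ; congr (_ + _).
have -> : (p \Po 'X^2) * 'X^2 * q = (p \Po 'X^2) * q * 'X * 'X by ring.
by rewrite even_polyMX odd_polyMX IH mulrAC.
Qed.

(** In t = w^2 the m-th polynomial is (t - 1)^(N - m) times an even part g of
    degree at most m.  As the even part of f takes the value
    (f(1) + f(-1)) / 2 at 1, g(1) = 4^m. *)
Lemma det_sym_cayley N : (2 : F) != 0 ->
  \det (coef_mx N (fun m => even_poly (sym_cayley F N m))) =
  (-1) ^+ rev_perm N.+1 * \prod_(i < N.+1) 4 ^+ i.
Proof.
move=> two0.
pose f m : {poly F} := ('X - 1) ^+ (m + m) + ('X + 1) ^+ (m + m) *+ (0 < m).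
have -> : coef_mx N (fun m => even_poly (sym_cayley F N m)) =
    coef_mx N (fun i => ('X - 1%:P) ^+ (N - i) * even_poly (f i)).
  apply/matrixP => i j; rewrite !mxE; congr (_`_j).
  rewrite -even_polyM_comp; congr even_poly.
  have iN : (i <= N)%N by rewrite -ltnS.
  rewrite rmorphXn rmorphB /= comp_polyX comp_polyC subr_sqr_1 exprMn
    /sym_cayley /cayley2 /cayley /f.
  rewrite mulrDr mulrnAr; congr (_ + _ *+ _).
    rewrite mulrAC -exprD; congr (_ ^+ _ * _ ^+ _); lia.
  rewrite -mulrA -exprD; congr (_ ^+ _ * _ ^+ _); lia.
rewrite (det_coef_mx_XsubC 1 (g := fun i => even_poly (f i))).
  congr (_ * _); apply: eq_bigr => i _.
  apply: (mulIf two0); rewrite mulr_natr horner_even_poly1 /f.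
  have ->: (f i).[1] = 4 ^+ i.
    rewrite /f hornerD hornerMn !horner_exp !hornerE subrr expr0n.
    case: (val i) => [|k]; rewrite ?addr0 //= add0r mulr1n.
    by rewrite exprD -exprMn; congr (_ ^+ _); ring.
  have ->: (f i).[-1] = 4 ^+ i.
    rewrite /f hornerD hornerMn !horner_exp !hornerE addNr expr0n.
    case: (val i) => [|k]; rewrite ?addr0 //=.
    by rewrite exprD -exprMn; congr (_ ^+ _); ring.
  by rewrite mulr_natr mulr2n.
move=> i _; apply: (leq_trans (size_even_poly _)).
have: (size (f i) <= (i + i).+1)%N.
  rewrite /f; apply: (leq_trans (size_polyD _ _)); rewrite geq_max.
  have -> : 'X + 1 = 'X - (-1)%:P :> {poly F} by rewrite polyCN opprK.
  rewrite -[1 in X in (X <= _)%N && _]polyC1 size_exp_XsubC leqnn /=.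
  case: (0 < i)%N; rewrite ?mulr1n ?mulr0n ?size_poly0 // size_exp_XsubC //.
move: (size _) => u; rewrite uphalf_half; lia.
Qed.

(** The determinants of the two sides of cayley_mx_fold; the signs of the
    reversals cancel, and the scalar (-1)^N contributes (-1)^(N (N + 1)) = 1. *)
Lemma det_fold_bordered_hurwitz N r : (2 : F) != 0 -> (size r <= N.+1)%N ->
  \det (fold_mx N r) * 2 ^+ 'C(N.+1, 2) = 2 ^+ N.+1 * \det
    (bordered_hurwitz N (mobius_upto N r)).
Proof.
move=> two0 sr.
have := congr1 determinant (cayley_mx_fold sr).
rewrite det_mulmx detZ det_mulmx det_tr det_cayley det_sym_cayley //.
have -> : \matrix_(k, s) ((-1) ^+ k *+ 2 * bordered_hurwitz N (mobius_upto N r) k s) =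
    diag_mx (\row_k ((-1) ^+ k *+ 2)) *m bordered_hurwitz N (mobius_upto N r).
  by apply/matrixP => i j; rewrite mul_diag_mx !mxE.
rewrite det_mulmx det_diag.
have -> : (-1) ^+ N ^+ N.+1 = 1 :> F.
  by rewrite -exprM -signr_odd oddM /= andbN.
have sg_neq0 b : (-1) ^+ b != 0 :> F by rewrite expf_neq0 // oppr_eq0 oner_eq0.
rewrite mul1r [RHS]mulrCA -!mulrA => /(mulfI (sg_neq0 _)).
rewrite mulrA -big_split /=.
have e : (\sum_(i < N.+1) i)%N = 'C(N.+1, 2).
  by rewrite -triangular_sum big_mkord.
have -> : \prod_(i < N.+1) ((-2) ^+ i * (\row_k ((-1) ^+ k *+ 2)) 0 i) =
    2 ^+ 'C(N.+1, 2) * 2 ^+ N.+1 :> F.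
  rewrite -e -prodrXr -[N.+1 in X in _ = _ * X]card_ord -prodr_const -big_split.
  apply: eq_bigr => i _ /=; rewrite mxE exprNn.
  have : (-1) ^+ i * (-1) ^+ i = 1 :> F by rewrite -exprMn mulrNN mulr1 expr1n.
  move: ((-1) ^+ i) (2 ^+ i) => x y x2.
  by transitivity (x * x * (y * 2)); [ring | rewrite x2 mul1r].
have -> : \prod_(i < N.+1) 4 ^+ i = 2 ^+ 'C(N.+1, 2) * 2 ^+ 'C(N.+1, 2) :> F.
  rewrite prodrXr e -exprMn; congr (_ ^+ _); ring.
rewrite -mulrA [in RHS]mulrC -!mulrA => /(mulfI (expf_neq0 _ two0)) ->.
by rewrite mulrC.
Qed.


(** Apart from p`_0 and p`_N.+1, at two opposite corners, the first and the last
    column are 0; what remains after deleting them is the Hurwitz matrix read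
    backwards. *)
Lemma det_bordered_hurwitz N p : (size p <= N.+2)%N ->
  \det (bordered_hurwitz N.+1 p) = p`_0 * p`_N.+1 * hurwitz_det N.+1 p.
Proof.
move=> sp.
rewrite (expand_det_col _ ord0) big_ord_recl big1 ?addr0; last first.
  by move=> i _; rewrite mxE coefXnM /= mul0r.
rewrite mxE coefXnM /= -mulrA; congr (_ * _).
rewrite /cofactor addn0 expr0 mul1r.
rewrite (expand_det_col _ ord_max) big_ord_recr big1 ?add0r; last first.
  move=> i _; rewrite !mxE coefXnM /= /bump /=.
  case: ltnP => _; rewrite ?mul0r //.
  by rewrite nth_default ?mul0r // (leq_trans sp) //; case: i => i /=; lia.
rewrite !mxE coefXnM /= /bump /= -addnn ltnNge leq_addr /=.
rewrite addnK add0r; congr (_ * _).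
rewrite /cofactor /= addnn -signr_odd odd_double expr0 mul1r.
rewrite /hurwitz_det -[RHS]det_rev /=; congr (\det _).
apply/matrixP => i j; rewrite !mxE coefXnM /= /bump /=.
case: i j => [i iN] [j jN] /=.
have [-> ->] : (N <= i)%N = false /\ (N <= j)%N = false by lia.
rewrite /= !add0n.
set z := (_ - _ : int).
have zE : z = (j.+1).*2%:Z - i.+1%:Z by rewrite /z; lia.
rewrite zE.
(* A negative index gives 0 in coefz as well as in the product by 'X^i. *)
case: ltnP => ij.
  have -> : (j.+1).*2%:Z - i.+1%:Z = Negz (i.+1 - (j.+1).*2).-1 by lia.
  by [].
by rewrite subzn.
Qed.

(** The point w = 0 corresponds to z = -1. *)
Lemma mobius_upto_coef0 N r : (size r <= N.+1)%N -> (mobius_upto N r)`_0 = r.[-1].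
Proof.
move=> sr; rewrite -horner_coef0 horner_sum (horner_coef_wide _ sr).
apply: eq_bigr => j _; rewrite hornerZ /cayley hornerM !horner_exp -polyC1.
by rewrite hornerXsubC hornerD hornerX hornerC sub0r add0r expr1n mulr1.
Qed.

(** The point at infinity of the w-line corresponds to z = 1. *)
Lemma mobius_upto_coefN N r : (size r <= N.+1)%N -> (mobius_upto N r)`_N = r.[1].
Proof.
move=> sr; rewrite coef_sum (horner_coef_wide _ sr).
apply: eq_bigr => j _; rewrite coefZ expr1n; congr (_ * _).
have -> : cayley F N j = ('X - 1%:P) ^+ j * ('X - (-1)%:P) ^+ (N - j).
  by rewrite polyCN opprK.
have jN : (j <= N)%N by rewrite -ltnS.
set p := _ * _; have mp : p \is monic by rewrite monicMl ?monic_exp ?monicXsubC.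
have sp : size p = N.+1.
  rewrite /p size_monicM ?monic_exp ?monicXsubC ?expf_neq0 ?polyXsubC_eq0 //.
  by rewrite !size_exp_XsubC addSn /= addnS subnKC.
by move/monicP: mp; rewrite lead_coefE sp.
Qed.

(** The bound on the size excludes N = 0, where the two corners of the border
    are the same entry and the identity fails. *)
Theorem det_fold_mobius r : (2 : F) != 0 -> (1 < size r)%N ->
  let N := (size r).-1 in
  \det (fold_mx N r) * 2 ^+ 'C(N.+1, 2) =
  2 ^+ N.+1 * (r.[1] * r.[-1] * hurwitz_det N (mobius r)).
Proof.
move=> two0 s1 N.
have sr : (size r <= N.+1)%N by rewrite /N prednK // ltnW.
rewrite det_fold_bordered_hurwitz //; congr (_ * _).
have -> : mobius r = mobius_upto N r by [].
move: sr; have : (0 < N)%N by rewrite /N; lia.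
case: N => // N _ sr.
by rewrite det_bordered_hurwitz ?size_mobius_upto // mobius_upto_coef0 //
  mobius_upto_coefN // [r.[1] * _]mulrC.
Qed.

End Dets.

(** * Vanishing integrals of derivatives over the disk *)

Section Disk.
Import numFieldNormedType.Exports.
Local Open Scope classical_set_scope.
Local Open Scope ring_scope.
Local Open Scope complex_scope.
Variable R : realType.
Notation leb := (@lebesgue_measure R).
Notation leb2 := (@lebesgue2 R).
Notation D := (@unit_disk R).

Lemma unit_diskE (p : R * R) : D p <-> p.1 ^+ 2 + p.2 ^+ 2 < 1.
Proof.
rewrite /unit_disk /= normc_def /= -(rmorph1 (real_complex R)) ltcR.
have s0 : 0 <= p.1 ^+ 2 + p.2 ^+ 2 by rewrite addr_ge0 ?sqr_ge0.
by rewrite -(@ltr_pXn2r _ 2) ?nnegrE ?sqrtr_ge0 // sqr_sqrtr // expr1n.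
Qed.

Notation T2 := (measurableTypeR R * measurableTypeR R)%type.

Lemma measurable_unit_disk : measurable (D : set T2).
Proof.
have -> : D = [set p | p.1 ^+ 2 + p.2 ^+ 2 < 1].
  by apply/seteqP; split => p /unit_diskE.
pose f (p : R * R) : R := p.1 ^+ 2 + p.2 ^+ 2.
have mf : measurable_fun setT f.
  by apply: measurable_funD; apply: measurable_funX;
     [exact: measurable_fst | exact: measurable_snd].
have -> : [set p | p.1 ^+ 2 + p.2 ^+ 2 < 1] = setT `&` f @^-1` `]-oo, 1[%classic.
  by apply/seteqP; split => p /=; rewrite in_itv /=; [move=> ?; split | case].
by apply: mf => //; exact: measurable_itv.
Qed.

Lemma unit_disk_lty : (lebesgue2 D < +oo)%E.
Proof.
have sD : D `<=` `[-1, 1]%classic `*` `[-1, 1]%classic.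
  move=> [x y] /unit_diskE /= xy; split => /=; rewrite in_itv /=;
    apply/andP; split; nra.
have mI : measurable (`[-1, 1]%classic : set R) by exact: measurable_itv.
rewrite /lebesgue2; apply: (@le_lt_trans _ _ ((leb \x leb)%E (`[-1, 1] `*` `[-1, 1]))).
  apply: le_measure => //; rewrite inE; first exact: measurable_unit_disk.
  exact: measurableX.
rewrite product_measure1E // [X in (X * X)%E](lebesgue_measure_itv `[-1,
  1]) /= lte_fin gtrN //.
by rewrite -EFinB -EFinM ltry.
Qed.

(** The slice is either empty or a chord, at both ends of which g vanishes. *)
Lemma slice_int_eq0 (x : R) (g g' : R -> R) :
    (forall y : R, is_derive y 1 g (g' y)) -> continuous g' ->
    (forall y, x ^+ 2 + y ^+ 2 = 1 -> g y = 0) ->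
  (\int[leb]_(y in [set y | x ^+ 2 + y ^+ 2 < 1]%R) (g' y)%:E = 0)%E.
Proof.
move=> dg cg g0; have [x1|x1] := ltP (x ^+ 2) 1; last first.
  rewrite (_ : [set _ | _] = set0) ?integral_set0 //.
  by apply/seteqP; split => y //= H; have := sqr_ge0 y; lra.
pose s := Num.sqrt (1 - x ^+ 2).
have s2 : s ^+ 2 = 1 - x ^+ 2 by rewrite sqr_sqrtr // subr_ge0 ltW.
have s0 : 0 < s by rewrite sqrtr_gt0 subr_gt0.
have -> : [set y | x ^+ 2 + y ^+ 2 < 1] = `]-s, s[%classic.
  apply/seteqP; split => y /=; rewrite in_itv /= => H.
    by apply/andP; split; nra.
  by case/andP: H => H1 H2; nra.
have cg' A : {within A, continuous g'} by apply: continuous_subspaceT.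
have mg A : measurable A -> measurable_fun A (EFin \o g').
  move=> mA; apply/measurable_EFinP; apply: measurable_funTS.
  exact: continuous_measurable_fun.
rewrite integral_itv_bndo_bndc; last exact: mg.
rewrite integral_itv_obnd_cbnd; last exact: mg.
have cgc : continuous g.
  by move=> y; apply: differentiable_continuous; apply/derivable1_diffP; case: (dg y).
rewrite (continuous_FTC2 (F := g)) ?gtrN //.
- by rewrite !g0 ?subee // ?sqrrN s2; ring.
- split; first by move=> y _; case: (dg y).
  + by apply: cvg_at_right_filter; exact: cgc.
  + by apply: cvg_at_left_filter; exact: cgc.
- by move=> y _; rewrite derive1E; apply: derive_val.
Qed.

Lemma disk_int_dy (g g' : R -> R -> R) :
    (forall x y : R, is_derive y 1 (g x) (g' x y)) ->
    (forall x, continuous (g' x)) ->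
    (forall x y, x ^+ 2 + y ^+ 2 = 1 -> g x y = 0) ->
    (leb \x leb)%E.-integrable D (EFin \o (fun p => g' p.1 p.2)) ->
  \int[leb2]_(p in D) g' p.1 p.2 = 0.
Proof.
move=> dg cg g0 ig; rewrite /Rintegral /lebesgue2 integral_mkcond.
have {}ig := (integrable_mkcond _ measurable_unit_disk).1 ig.
rewrite -[X in fine X = _](integral12_prod_meas1 ig) /fubini_F.
under eq_integral => x _.
  have -> : (fun y => ((EFin \o (fun p => g' p.1 p.2)) \_ D) (x, y)) =
            (fun y => (EFin \o g' x) \_ [set y | x ^+ 2 + y ^+ 2 < 1] y).
    apply/funext => y; rewrite !patchE.
    have -> // : ((x, y) \in D) = (y \in [set y | x ^+ 2 + y ^+ 2 < 1]).
    by have /= E := unit_diskE (x, y); apply/idP/idP; rewrite !inE => /E.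
  rewrite -integral_mkcond (slice_int_eq0 (dg x) (cg x) (g0 x)).
over.
by rewrite integral0.
Qed.

Lemma disk_int_dx (g g' : R -> R -> R) :
    (forall x y : R, is_derive x 1 (g^~ y) (g' x y)) ->
    (forall y, continuous (g'^~ y)) ->
    (forall x y, x ^+ 2 + y ^+ 2 = 1 -> g x y = 0) ->
    (leb \x leb)%E.-integrable D (EFin \o (fun p => g' p.1 p.2)) ->
  \int[leb2]_(p in D) g' p.1 p.2 = 0.
Proof.
move=> dg cg g0 ig; rewrite /Rintegral /lebesgue2 integral_mkcond.
have {}ig := (integrable_mkcond _ measurable_unit_disk).1 ig.
rewrite -[X in fine X = _](integral21_prod_meas1 ig) /fubini_G.
under eq_integral => y _.
  have -> : (fun x => ((EFin \o (fun p => g' p.1 p.2)) \_ D) (x, y)) =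
            (fun x => (EFin \o (g'^~ y)) \_ [set x | y ^+ 2 + x ^+ 2 < 1] x).
    apply/funext => x; rewrite !patchE.
    have -> // : ((x, y) \in D) = (x \in [set x | y ^+ 2 + x ^+ 2 < 1]).
    by have /= E := unit_diskE (x, y); apply/idP/idP; rewrite !inE /= addrC => /E.
  rewrite -integral_mkcond (@slice_int_eq0 y (g^~ y) (g'^~ y)) //; last first.
    by move=> x; rewrite addrC; exact: g0.
over.
by rewrite integral0.
Qed.

End Disk.

(** * The area of the disk *)

Section Area.
Import numFieldNormedType.Exports.
Local Open Scope classical_set_scope.
Local Open Scope ring_scope.
Local Open Scope complex_scope.
Variable R : realType.
Notation leb := (@lebesgue_measure R).
Notation D := (@unit_disk R).

(** At the end points, where asin is not differentiable, continuity comes from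
    asin being the inverse of the restriction of sin. *)
Lemma continuous_within_asin : {within `[-1, 1], continuous (@asin R)}.
Proof.
have pi2 : - (pi / 2) <= pi / 2 :> R by have := pi_ge0 R; lra.
have cs : {within `[- (pi / 2), pi / 2], continuous (@sin R)}.
  by apply: continuous_subspaceT => x; exact: continuous_sin.
by have := segment_can_le_continuous pi2 cs (@sinK R); rewrite sinN sin_pihalf.
Qed.

Lemma continuous_halfcircle : continuous (fun x : R => Num.sqrt (1 - x ^+ 2)).
Proof.
move=> x; apply: (@continuous_comp _ _ _ (fun x : R => 1 - x ^+ 2) Num.sqrt);
  last exact: sqrt_continuous.
by apply: cvgB; [exact: cvg_cst | exact: exprn_continuous].
Qed.

(** An antiderivative is x sqrt(1 - x^2) + asin x. *)
Lemma integral_halfcircle :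
  (\int[leb]_(x in [set` `[-1, 1]%R]) (2 * Num.sqrt (1 - x ^+ 2))%:E = (pi : R)%:E)%E.
Proof.
pose F (x : R) := x * Num.sqrt (1 - x ^+ 2) + asin x.
have cF : {within `[-1, 1], continuous F}.
  move=> x; apply: cvgD; last exact: continuous_within_asin.
  apply: (@continuous_subspaceT _ _ _ (fun x : R => x * Num.sqrt (1 - x ^+ 2))) => z.
  by apply: cvgM; [exact: cvg_id | exact: continuous_halfcircle].
have N11 : -1 < 1 :> R by rewrite gtrN.
have dF (x : R) : x \in `]-1, 1[ -> is_derive x 1 F (2 * Num.sqrt (1 - x ^+ 2)).
  rewrite in_itv /= => /andP[x1 x2].
  have xx : 0 < 1 - x ^+ 2 by nra.
  have x11 : -1 < x < 1 by apply/andP.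
  have d1 : is_derive x 1 (fun x : R => 1 - x ^+ 2) (- (2 * x)).
    by apply: is_derive_eq; rewrite /GRing.scale /=; ring.
  have d2 := @is_derive1_comp R Num.sqrt (fun x : R => 1 - x ^+ 2) x _ _
    (is_derive1_sqrt xx) d1.
  have d3 := is_deriveD (is_deriveM (is_derive_id x 1) d2) (is_derive1_asin x11).
  apply: is_derive_eq d3 _; rewrite /GRing.scale /=.
  have s0 : Num.sqrt (1 - x ^+ 2) != 0 by rewrite gt_eqF // sqrtr_gt0.
  have s2 : Num.sqrt (1 - x ^+ 2) ^+ 2 = 1 - x ^+ 2 by rewrite sqr_sqrtr // ltW.
  move: (Num.sqrt _) s0 s2 => s s0 s2.
  by transitivity ((1 - x ^+ 2) / s + s); [field | rewrite -s2; field].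
rewrite (continuous_FTC2 (F := F)) //.
- rewrite /F sqrrN expr1n subrr sqrtr0 !mulr0 !add0r.
  have asin1 : asin 1 = pi / 2 :> R.
    rewrite -[in LHS](sin_pihalf R) sinK // in_itv /= lexx andbT.
    by have := pi_ge0 R; lra.
  have asinN1 : asin (-1) = - (pi / 2) :> R.
    rewrite -[in LHS](sin_pihalf R) -sinN sinK // in_itv /= lexx.
    by have := pi_ge0 R; lra.
  by rewrite asin1 asinN1 -EFinB opprK -splitr.
- move=> x; apply: cvgM; first exact: cvg_cst.
  by apply: continuous_subspaceT; exact: continuous_halfcircle.
- have [cF1 cF2 cF3] := (continuous_within_itvP F N11).1 cF.
  by split=> // x /dF[].
- by move=> x /dF dFx; rewrite derive1E; apply: derive_val.
Qed.

(** For |x| >= 1 the square root is 0, so the length of every slice is given by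
    the same formula. *)
Lemma unit_disk_area : (leb \x leb)%E D = (pi : R)%:E.
Proof.
transitivity (\int[leb]_x (2 * Num.sqrt (1 - x ^+ 2))%:E)%E.
  apply: eq_integral => x _ /=.
  have -> : xsection D x = `]- Num.sqrt (1 - x ^+ 2), Num.sqrt (1 - x ^+ 2)[%classic.
    apply/seteqP; split => y; rewrite /xsection /= in_itv /= inE.
      move=> /unit_diskE /= xy; rewrite -ltr_norml.
      rewrite -(@ltr_pXn2r _ 2) ?nnegrE ?sqrtr_ge0 // sqr_sqrtr; last nra.
      by rewrite real_normK ?num_real //; lra.
    rewrite -ltr_norml => yx; apply/unit_diskE => /=.
    have x1 : 0 < 1 - x ^+ 2 by rewrite -sqrtr_gt0 (le_lt_trans _ yx).
    move: yx; rewrite -(@ltr_pXn2r _ 2) ?nnegrE ?sqrtr_ge0 // sqr_sqrtr ?ltW //.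
    by rewrite real_normK ?num_real //; lra.
  rewrite lebesgue_measure_itv /= lte_fin.
  have := sqrtr_ge0 (1 - x ^+ 2); move: (Num.sqrt _) => s s0.
  case: ifPn => [_|]; first by rewrite -EFinB opprK; congr EFin; ring.
  rewrite -leNgt => s1; congr EFin; lra.
rewrite -integral_halfcircle [RHS]integral_mkcond; apply: eq_integral => x _.
rewrite patchE; case: ifPn => //; rewrite notin_setE /= in_itv /=.
move=> /negP; rewrite negb_and -!ltNge => xB.
rewrite ler0_sqrtr ?mulr0 //; case/orP: xB; nra.
Qed.

End Area.

(** * Complex monomials on the disk *)

Section Cplx.
Import numFieldNormedType.Exports.
Local Open Scope classical_set_scope.
Local Open Scope ring_scope.
Local Open Scope complex_scope.
Variable R : realType.
Notation leb := (@lebesgue_measure R).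
Notation leb2 := (@lebesgue2 R).
Notation D := (@unit_disk R).
Notation C := R[i].
Notation T2 := (measurableTypeR R * measurableTypeR R)%type.
Notation Re := (@complex.Re R).
Notation Im := (@complex.Im R).

Lemma ReM (z w : C) : Re (z * w) = Re z * Re w - Im z * Im w.
Proof. by case: z w => [a b] [c d]. Qed.

Lemma ImM (z w : C) : Im (z * w) = Re z * Im w + Im z * Re w.
Proof. by case: z w => [a b] [c d]. Qed.

Lemma ReD (z w : C) : Re (z + w) = Re z + Re w.
Proof. by case: z w => [a b] [c d]. Qed.

Lemma ImD (z w : C) : Im (z + w) = Im z + Im w.
Proof. by case: z w => [a b] [c d]. Qed.

(** The derivative is taken by components, so that R[i] is used only as a
    ring. *)
Definition cderive (f : R -> C) (x : R) (d : C) :=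
  is_derive x 1 (Re \o f) (Re d) /\ is_derive x 1 (Im \o f) (Im d).

Lemma cderive_cst c x : cderive (cst c) x 0.
Proof. by split; exact: is_derive_cst. Qed.

Lemma cderiveD f g x a b : cderive f x a -> cderive g x b ->
  cderive (fun x => f x + g x) x (a + b).
Proof.
move=> [f1 f2] [g1 g2]; split.
- have -> : Re \o (fun x => f x + g x) = (Re \o f) + (Re \o g).
    by apply/funext => y /=; rewrite ReD.
  by apply: is_derive_eq; rewrite ReD.
- have -> : Im \o (fun x => f x + g x) = (Im \o f) + (Im \o g).
    by apply/funext => y /=; rewrite ImD.
  by apply: is_derive_eq; rewrite ImD.
Qed.

Lemma cderiveM f g x a b : cderive f x a -> cderive g x b ->
  cderive (fun x => f x * g x) x (a * g x + f x * b).
Proof.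
move=> [f1 f2] [g1 g2]; split.
- have -> : Re \o (fun x => f x * g x) = (Re \o f) * (Re \o g) - (Im \o f) * (Im \o g).
    by apply/funext => y /=; rewrite ReM.
  by apply: is_derive_eq; rewrite ReD !ReM /GRing.scale /=; ring.
- have -> : Im \o (fun x => f x * g x) = (Re \o f) * (Im \o g) + (Im \o f) * (Re \o g).
    by apply/funext => y /=; rewrite ImM.
  by apply: is_derive_eq; rewrite ImD !ImM /GRing.scale /=; ring.
Qed.

Lemma cderiveX f x a n : cderive f x a ->
  cderive (fun x => f x ^+ n) x (n%:R * a * f x ^+ n.-1).
Proof.
move=> df; elim: n => [|n IH]; first by rewrite !mul0r; exact: (cderive_cst 1 x).
have := cderiveM df IH; congr cderive.
  by apply/funext => y; rewrite exprS.
case: n {IH} => [|n] /=; first by rewrite !mul0r mulr0 addr0 mul1r expr0 mulr1.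
rewrite [f x ^+ n.+1]exprS -[in RHS]natr1; ring.
Qed.

(** The function z^p (conj z)^q at z = x + i y. *)
Definition zmon p q (x y : R) : C := (x +i* y) ^+ p * (x -i* y) ^+ q.

Definition zmon_dx p q x y : C := p%:R * zmon p.-1 q x y + q%:R * zmon p q.-1 x y.
Definition zmon_dy p q x y : C :=
  'i%C * (p%:R * zmon p.-1 q x y - q%:R * zmon p q.-1 x y).

Lemma cderive_zmon_dx p q (x y : R) : cderive (fun x => zmon p q x y) x
  (zmon_dx p q x y).
Proof.
have d1 : cderive (fun x => x +i* y) x 1.
  by split; [exact: is_derive_id | exact: is_derive_cst].
have d2 : cderive (fun x => x -i* y) x 1.
  by split; [exact: is_derive_id | exact: is_derive_cst].
have := cderiveM (cderiveX p d1) (cderiveX q d2); congr cderive.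
by rewrite /zmon_dx /zmon; ring.
Qed.

Lemma cderive_zmon_dy p q (x y : R) : cderive (zmon p q x) y (zmon_dy p q x y).
Proof.
have d1 : cderive (fun y => x +i* y) y 'i%C.
  by split; [exact: is_derive_cst | exact: is_derive_id].
have d2 : cderive (fun y => x -i* y) y (- 'i%C).
  split; first by rewrite /= oppr0; exact: is_derive_cst.
  by apply: is_derive_eq.
have := cderiveM (cderiveX p d1) (cderiveX q d2); congr cderive.
by rewrite /zmon_dy /zmon; move: (x +i* y) (x -i* y) => z w; ring.
Qed.

Definition ccontinuous (f : R -> C) := continuous (Re \o f) /\ continuous (Im \o f).

Lemma ccontinuous_cst c : ccontinuous (cst c).
Proof. by split => x; exact: cst_continuous. Qed.

Lemma ccontinuousD f g : ccontinuous f -> ccontinuous g ->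
  ccontinuous (fun x => f x + g x).
Proof.
move=> [f1 f2] [g1 g2]; split => x.
- have -> : Re \o (fun x => f x + g x) = (Re \o f) + (Re \o g).
    by apply/funext => y /=; rewrite ReD.
  by apply: cvgD; [exact: f1 | exact: g1].
- have -> : Im \o (fun x => f x + g x) = (Im \o f) + (Im \o g).
    by apply/funext => y /=; rewrite ImD.
  by apply: cvgD; [exact: f2 | exact: g2].
Qed.

Lemma ccontinuousM f g : ccontinuous f -> ccontinuous g ->
  ccontinuous (fun x => f x * g x).
Proof.
move=> [f1 f2] [g1 g2]; split => x.
- have -> : Re \o (fun x => f x * g x) = (Re \o f) * (Re \o g) - (Im \o f) * (Im \o g).
    by apply/funext => y /=; rewrite ReM.
  by apply: cvgB; apply: cvgM; [exact: f1 | exact: g1 | exact: f2 | exact: g2].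
- have -> : Im \o (fun x => f x * g x) = (Re \o f) * (Im \o g) + (Im \o f) * (Re \o g).
    by apply/funext => y /=; rewrite ImM.
  by apply: cvgD; apply: cvgM; [exact: f1 | exact: g2 | exact: f2 | exact: g1].
Qed.

Lemma cderive_continuous f df : (forall x, cderive f x (df x)) -> ccontinuous f.
Proof.
move=> fdf; split => x; apply: differentiable_continuous; apply/derivable1_diffP;
  by have [[? _] [? _]] := fdf x.
Qed.

Definition cmeasurable (f : T2 -> C) :=
  measurable_fun setT (Re \o f) /\ measurable_fun setT (Im \o f).

Lemma cmeasurableM f g : cmeasurable f -> cmeasurable g ->
  cmeasurable (fun p => f p * g p).
Proof.
move=> [f1 f2] [g1 g2]; split.
- have -> : Re \o (fun x => f x * g x) =
      (fun p => (Re \o f) p * (Re \o g) p - (Im \o f) p * (Im \o g) p).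
    by apply/funext => y /=; rewrite ReM.
  by apply: measurable_funB; apply: measurable_funM.
- have -> : Im \o (fun x => f x * g x) =
      (fun p => (Re \o f) p * (Im \o g) p + (Im \o f) p * (Re \o g) p).
    by apply/funext => y /=; rewrite ImM.
  by apply: measurable_funD; apply: measurable_funM.
Qed.

Lemma cmeasurableX f n : cmeasurable f -> cmeasurable (fun p => f p ^+ n).
Proof.
move=> mf; elim: n => [|n IH]; first by split; exact: measurable_cst.
by have := cmeasurableM mf IH; congr cmeasurable; apply/funext => p; rewrite exprS.
Qed.

Lemma cmeasurable_zmon p q : cmeasurable (fun z => zmon p q z.1 z.2).
Proof.
apply: cmeasurableM; apply: cmeasurableX; split.
- exact: measurable_fst.
- exact: measurable_snd.
- exact: measurable_fst.
- by apply: measurable_funN; exact: measurable_snd.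
Qed.

Definition cintegrable (f : T2 -> C) :=
  (leb \x leb)%E.-integrable D (EFin \o (Re \o f)) /\
  (leb \x leb)%E.-integrable D (EFin \o (Im \o f)).

Lemma norm_zmon p q z : D z -> `|zmon p q z.1 z.2| <= 1.
Proof.
move=> Dz; rewrite normrM !normrX.
have z1 : `|z.1 +i* z.2| <= 1 by apply: ltW.
have z2 : `|z.1 -i* z.2| <= 1 by rewrite -normcJ /= opprK.
by rewrite -[1]mulr1; apply: ler_pM; rewrite ?exprn_ge0 // exprn_ile1.
Qed.

Lemma cintegrable_zmon p q : cintegrable (fun z => zmon p q z.1 z.2).
Proof.
have [mR mI] := cmeasurable_zmon p q.
have bd (f : T2 -> R) : (forall z, D z -> `|f z| <= 1) -> [bounded f x | x in D].
  move=> fb; exists 1; split; first exact: num_real.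
  by move=> M M1 z /= Dz; apply: le_trans (fb z Dz) (ltW M1).
split; apply: measurable_bounded_integrable => //;
  try exact: measurable_unit_disk; try exact: unit_disk_lty;
  try exact: measurable_funTS; apply: bd => z Dz /=.
- have := le_trans (normc_ge_Re _) (norm_zmon p q Dz).
  by rewrite lecR.
- have := normc_ge_Re (zmon p q z.1 z.2 * 'i%C).
  have -> : `|zmon p q z.1 z.2 * 'i%C| = `|zmon p q z.1 z.2|.
    by rewrite normrM [`|'i%C|]normc_def /= expr0n expr1n add0r sqrtr1 mulr1.
  rewrite ReiNIm normrN => /le_trans /(_ (norm_zmon p q Dz)).
  by rewrite lecR.
Qed.

Lemma cintegrableD f g : cintegrable f -> cintegrable g ->
  cintegrable (fun p => f p + g p).
Proof.
move=> [f1 f2] [g1 g2]; split.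
- have -> : EFin \o (Re \o (fun x => f x + g x)) =
      (EFin \o (Re \o f)) \+ (EFin \o (Re \o g)).
    by apply/funext => y /=; rewrite ReD EFinD.
  apply: integrableD; [exact: measurable_unit_disk|exact: f1|exact: g1].
- have -> : EFin \o (Im \o (fun x => f x + g x)) =
      (EFin \o (Im \o f)) \+ (EFin \o (Im \o g)).
    by apply/funext => y /=; rewrite ImD EFinD.
  apply: integrableD; [exact: measurable_unit_disk|exact: f2|exact: g2].
Qed.

Lemma cintegrableZ c f : cintegrable f -> cintegrable (fun p => c * f p).
Proof.
move=> [f1 f2]; have mD := @measurable_unit_disk R; split.
- have -> : EFin \o (Re \o (fun x => c * f x)) =
     (fun x => (Re c)%:E * (EFin \o (Re \o f)) x)%E \+
     (fun x => (- Im c)%:E * (EFin \o (Im \o f)) x)%E.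
    by apply/funext => y /=; rewrite ReM -mulNr EFinD !EFinM.
  by apply: integrableD => //; apply: integrableZl.
- have -> : EFin \o (Im \o (fun x => c * f x)) =
     (fun x => (Re c)%:E * (EFin \o (Im \o f)) x)%E \+
     (fun x => (Im c)%:E * (EFin \o (Re \o f)) x)%E.
    by apply/funext => y /=; rewrite ImM EFinD.
  by apply: integrableD => //; apply: integrableZl.
Qed.

Lemma cintegrable0 : cintegrable (cst 0).
Proof. by split; exact: integrable0. Qed.

Lemma cintegrable_sum I (r : seq I) (F : I -> T2 -> C) :
  (forall i, cintegrable (F i)) -> cintegrable (fun p => \sum_(i <- r) F i p).
Proof.
move=> iF; elim: r => [|i r IH].
  by have := cintegrable0; congr cintegrable; apply/funext => p; rewrite big_nil.
have := cintegrableD (iF i) IH.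
by congr cintegrable; apply/funext => p; rewrite big_cons.
Qed.

(** The integrand depends on the two real coordinates, so that its partial
    derivatives make sense. *)
Definition diskint (f : T2 -> C) : C :=
  (\int[leb2]_(p in D) Re (f p)) +i* (\int[leb2]_(p in D) Im (f p)).

Lemma diskintD f g : cintegrable f -> cintegrable g ->
  diskint (fun p => f p + g p) = diskint f + diskint g.
Proof.
move=> [f1 f2] [g1 g2]; have mD := @measurable_unit_disk R.
rewrite /diskint /lebesgue2; apply/eqP; rewrite eq_complex /=;
  apply/andP; split; apply/eqP.
- by under eq_Rintegral do rewrite ReD; exact: RintegralD.
- by under eq_Rintegral do rewrite ImD; exact: RintegralD.
Qed.

Lemma integrable_scale (k : R) (g : T2 -> R) :
  (leb \x leb)%E.-integrable D (EFin \o g) ->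
  (leb \x leb)%E.-integrable D (EFin \o (fun p => k * g p)).
Proof.
move=> ig; have -> : EFin \o (fun p => k * g p) = (fun p => k%:E * (EFin \o g) p)%E.
  by apply/funext => p; rewrite /= EFinM.
by apply: integrableZl => //; exact: measurable_unit_disk.
Qed.

Lemma diskintZ c f : cintegrable f -> diskint (fun p => c * f p) = c * diskint f.
Proof.
move=> [f1 f2]; have mD := @measurable_unit_disk R.
rewrite /diskint /lebesgue2; apply/eqP; rewrite eq_complex /= ReM ImM /=;
  apply/andP; split; apply/eqP.
- under eq_Rintegral do rewrite ReM.
  rewrite RintegralB //; first by rewrite !RintegralZl.
  + exact: integrable_scale.
  + exact: integrable_scale.
- under eq_Rintegral do rewrite ImM.
  rewrite RintegralD //; first by rewrite !RintegralZl.
  + exact: integrable_scale.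
  + exact: integrable_scale.
Qed.

Lemma diskint0 : diskint (cst 0) = 0.
Proof. by rewrite /diskint /= /Rintegral !integral0. Qed.

Lemma diskint_sum I (r : seq I) (F : I -> T2 -> C) :
  (forall i, cintegrable (F i)) ->
  diskint (fun p => \sum_(i <- r) F i p) = \sum_(i <- r) diskint (F i).
Proof.
move=> iF; elim: r => [|i r IH].
  rewrite big_nil; transitivity (diskint (cst 0)); last exact: diskint0.
  by congr diskint; apply/funext => p; rewrite big_nil.
rewrite big_cons -IH -diskintD //; last exact: cintegrable_sum.
by congr diskint; apply/funext => p; rewrite big_cons.
Qed.

Lemma diskint_dx (g g' : R -> R -> C) :
    (forall x y, cderive (g^~ y) x (g' x y)) ->
    (forall y, ccontinuous (g'^~ y)) ->
    (forall x y, x ^+ 2 + y ^+ 2 = 1 -> g x y = 0) ->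
    cintegrable (fun p => g' p.1 p.2) ->
  diskint (fun p => g' p.1 p.2) = 0.
Proof.
move=> dg cg g0 [i1 i2]; rewrite /diskint.
apply/eqP; rewrite eq_complex /=; apply/andP; split; apply/eqP.
- apply: (@disk_int_dx R (fun x y => Re (g x y)) (fun x y => Re (g' x y))) => //.
  + by move=> x y; have [] := dg x y.
  + by move=> t; have [] := cg t.
  + by move=> x y /g0 ->.
- apply: (@disk_int_dx R (fun x y => Im (g x y)) (fun x y => Im (g' x y))) => //.
  + by move=> x y; have [] := dg x y.
  + by move=> t; have [] := cg t.
  + by move=> x y /g0 ->.
Qed.

Lemma diskint_dy (g g' : R -> R -> C) :
    (forall x y, cderive (g x) y (g' x y)) ->
    (forall x, ccontinuous (g' x)) ->
    (forall x y, x ^+ 2 + y ^+ 2 = 1 -> g x y = 0) ->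
    cintegrable (fun p => g' p.1 p.2) ->
  diskint (fun p => g' p.1 p.2) = 0.
Proof.
move=> dg cg g0 [i1 i2]; rewrite /diskint.
apply/eqP; rewrite eq_complex /=; apply/andP; split; apply/eqP.
- apply: (@disk_int_dy R (fun x y => Re (g x y)) (fun x y => Re (g' x y))) => //.
  + by move=> x y; have [] := dg x y.
  + by move=> t; have [] := cg t.
  + by move=> x y /g0 ->.
- apply: (@disk_int_dy R (fun x y => Im (g x y)) (fun x y => Im (g' x y))) => //.
  + by move=> x y; have [] := dg x y.
  + by move=> t; have [] := cg t.
  + by move=> x y /g0 ->.
Qed.

Notation J p q := (diskint (fun z => zmon p q z.1 z.2)).

(** On the unit circle z (conj z) = 1, so zmon p q - zmon p.+1 q.+1 vanishes
    there. *)
Lemma zmon_circle p q x y : x ^+ 2 + y ^+ 2 = 1 -> zmon p.+1 q.+1 x y = zmon p q x y.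
Proof.
move=> xy; rewrite /zmon !exprS mulrACA.
have -> : (x +i* y) * (x -i* y) = 1.
  by apply/eqP; rewrite eq_complex /= -[1]xy; apply/andP; split; apply/eqP; ring.
by rewrite mul1r.
Qed.

(** The integral of the x-derivative of (1 - |z|^2) z^p (conj z)^q. *)
Lemma diskint_zmon_dx p q :
  p%:R * J p.-1 q + q%:R * J p q.-1 - (p.+1%:R * J p q.+1 + q.+1%:R * J p.+1 q) = 0.
Proof.
have im := cintegrable_zmon.
pose g' x y := zmon_dx p q x y + (-1) * zmon_dx p.+1 q.+1 x y.
have <- : diskint (fun z => g' z.1 z.2) = 0.
  apply: (@diskint_dx (fun x y => zmon p q x y + (-1) * zmon p.+1 q.+1 x y)).
  - move=> x y; apply: cderiveD; first exact: cderive_zmon_dx.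
    have := cderiveM (cderive_cst (-1) x) (cderive_zmon_dx p.+1 q.+1 x y).
    by congr cderive; rewrite mul0r add0r.
  - have cm p' q' y : ccontinuous (fun x => zmon p' q' x y).
      exact: cderive_continuous (fun x => cderive_zmon_dx p' q' x y).
    have cmx p' q' y : ccontinuous (fun x => zmon_dx p' q' x y).
      by apply: ccontinuousD; apply: ccontinuousM => //; exact: ccontinuous_cst.
    move=> y; apply: ccontinuousD => //; apply: ccontinuousM => //.
    exact: ccontinuous_cst.
  - by move=> x y /zmon_circle ->; ring.
  - apply: cintegrableD; last apply: cintegrableZ; apply: cintegrableD;
    exact: cintegrableZ.
have imx p' q' : cintegrable (fun z => zmon_dx p' q' z.1 z.2).
  by apply: cintegrableD; exact: cintegrableZ.
rewrite diskintD //; last exact: cintegrableZ.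
rewrite diskintZ // diskintD ?diskintD ?diskintZ //; try exact: cintegrableZ.
by rewrite mulN1r.
Qed.

(** The integral of the y-derivative of (1 - |z|^2) z^p (conj z)^q, divided
    by i. *)
Lemma diskint_zmon_dy p q :
  p%:R * J p.-1 q - q%:R * J p q.-1 - (p.+1%:R * J p q.+1 - q.+1%:R * J p.+1 q) = 0.
Proof.
have im := cintegrable_zmon.
pose g' x y := zmon_dy p q x y + (-1) * zmon_dy p.+1 q.+1 x y.
have imy p' q' : cintegrable (fun z => p'%:R * zmon p'.-1 q' z.1 z.2 -
  q'%:R * zmon p' q'.-1 z.1 z.2).
  have := cintegrableD (cintegrableZ p'%:R (im p'.-1 q')) (cintegrableZ
    (- q'%:R) (im p' q'.-1)).
  by congr cintegrable; apply/funext => z; rewrite mulNr.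
have imony p' q' : cintegrable (fun z => zmon_dy p' q' z.1 z.2) :=
  cintegrableZ 'i%C (imy p' q').
have Jy p' q' : diskint (fun z => zmon_dy p' q' z.1 z.2) =
    'i%C * (p'%:R * J p'.-1 q' - q'%:R * J p' q'.-1).
  rewrite diskintZ //; congr (_ * _).
  rewrite -mulNr -[X in X + _]diskintZ // -[X in _ +
    X]diskintZ // -diskintD; try exact: cintegrableZ.
  by congr diskint; apply/funext => z; rewrite mulNr.
have : diskint (fun z => g' z.1 z.2) = 0.
  apply: (@diskint_dy (fun x y => zmon p q x y + (-1) * zmon p.+1 q.+1 x y)).
  - move=> x y; apply: cderiveD; first exact: cderive_zmon_dy.
    have := cderiveM (cderive_cst (-1) y) (cderive_zmon_dy p.+1 q.+1 x y).
    by congr cderive; rewrite mul0r add0r.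
  - have cm p' q' x : ccontinuous (zmon p' q' x).
      exact: cderive_continuous (fun y => cderive_zmon_dy p' q' x y).
    have cmy p' q' x : ccontinuous (zmon_dy p' q' x).
      have cc c : ccontinuous (fun=> c) := ccontinuous_cst c.
      have := ccontinuousM (cc 'i%C) (ccontinuousD (ccontinuousM (cc
        p'%:R) (cm p'.-1 q' x))
                                              (ccontinuousM (cc (-
                                                q'%:R)) (cm p' q'.-1 x))).
      by congr ccontinuous; apply/funext => y; rewrite mulNr.
    move=> x; apply: ccontinuousD => //; apply: ccontinuousM => //.
    exact: ccontinuous_cst.
  - by move=> x y /zmon_circle ->; ring.
  - by apply: cintegrableD => //; exact: cintegrableZ.
rewrite diskintD //; last exact: cintegrableZ.
rewrite (diskintZ (-1)) // !Jy mulN1r -mulrBr => /eqP;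
  rewrite mulf_eq0 => /orP[|/eqP //].
by rewrite eq_complex /= oner_eq0 andbF.
Qed.

Lemma diskint_zmon00 : J 0 0 = pi%:C.
Proof.
rewrite /diskint /zmon /= /lebesgue2.
under eq_Rintegral do rewrite mulr1.
rewrite !Rintegral_cst; try exact: measurable_unit_disk.
by rewrite [X in fine X](@unit_disk_area R) /= !mul0r mulr0 addr0 subr0 mul1r mul0r.
Qed.

(** The sum of the two divergence identities, that is, the one for the
    Wirtinger derivative d/dz. *)
Lemma diskint_zmon_recr p q : p.+1%:R * J p q.+1 = p%:R * J p.-1 q.
Proof.
have := diskint_zmon_dx p q; have := diskint_zmon_dy p q.
move: (p%:R * J p.-1 q) (q%:R * J p q.-1) (p.+1%:R * J p q.+1) (q.+1%:R * J p.+1 q).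
move=> a b c d H1 H2; have := congr2 +%R H1 H2; rewrite addr0 => H.
apply/eqP; rewrite eq_sym -subr_eq0; apply/eqP.
have /mulfI : (2 : C) != 0 by rewrite pnatr_eq0.
by apply; rewrite mulr0 -[RHS]H; ring.
Qed.

Lemma diskint_zmon_recl p q : q.+1%:R * J p.+1 q = q%:R * J p q.-1.
Proof.
have := diskint_zmon_dx p q; rewrite diskint_zmon_recr => H; apply/eqP;
  rewrite eq_sym -subr_eq0.
by apply/eqP; rewrite -[RHS]H; ring.
Qed.

(** The recurrences lower both exponents by one at the same time, until one of
    them is 0: the integral is then 0 unless both are 0. *)
Lemma diskint_zmon p q : J p q = (p == q)%:R * (pi%:C / p.+1%:R).
Proof.
have nz n : (n.+1%:R : C) != 0 by rewrite pnatr_eq0.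
elim: q p => [|q IH] [|p].
- by rewrite diskint_zmon00 mul1r divr1.
- by apply: (mulfI (nz 0%N)); rewrite diskint_zmon_recl !mul0r mulr0.
- by apply: (mulfI (nz 0%N)); rewrite diskint_zmon_recr !mul0r mulr0.
apply: (mulfI (nz p.+1)); rewrite diskint_zmon_recr /= IH eqSS.
by rewrite mulrCA [RHS]mulrCA; congr (_ * _);
  rewrite ![_ * (_ / _)]mulrC !divfK.
Qed.

End Cplx.

(** * Moments and their derivatives *)

Section Mom.
Import numFieldNormedType.Exports.
Local Open Scope classical_set_scope.
Local Open Scope ring_scope.
Local Open Scope complex_scope.
Variable R : realType.
Notation C := R[i].

Lemma diskint_poly (A B : {poly C}) n : (size B <= n)%N ->
  diskint (fun p => A.[p.1 +i* p.2] * B.[p.1 -i* p.2]) =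
  (pi : R)%:C * \sum_(j < n) A`_j * B`_j / j.+1%:R.
Proof.
move=> sB; pose m := maxn (size A) n.
have cm (i j : nat) : cintegrable (fun z => (A`_i * B`_j) * zmon i j z.1 z.2).
  exact: cintegrableZ (cintegrable_zmon R i j).
transitivity (diskint (fun p => \sum_(j < n) \sum_(i < m) (A`_i * B`_j) *
  zmon i j p.1 p.2)).
  congr diskint; apply/funext => p.
  rewrite (horner_coef_wide _ sB) (@horner_coef_wide _ m A); last exact: leq_maxl.
  rewrite mulr_sumr; apply: eq_bigr => j _; rewrite mulr_suml; apply: eq_bigr => i _.
  by rewrite /zmon mulrACA.
rewrite diskint_sum; last by move=> j; apply: cintegrable_sum.
rewrite mulr_sumr; apply: eq_bigr => j _.
rewrite diskint_sum //.
have jm : (j < m)%N by rewrite (leq_trans (ltn_ord j)) // leq_maxr.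
rewrite (bigD1 (Ordinal jm)) //= big1 => [|i].
  rewrite addr0 diskintZ; last exact: cintegrable_zmon.
  by rewrite diskint_zmon eqxx mul1r mulrCA.
rewrite -val_eqE /= => /negPf ij; rewrite diskintZ; last exact: cintegrable_zmon.
by rewrite diskint_zmon ij mul0r mulr0.
Qed.

Lemma horner_conj_real (Q : {poly R}) (z : C) :
  (map_poly (real_complex R) Q).[z]^*%C = (map_poly (real_complex R) Q).[z^*%C].
Proof.
rewrite -[LHS]/(conjc _) -horner_map; congr (_.[_]).
by apply/polyP => i; rewrite !coef_map /= oppr0.
Qed.

(** The k-th moment as a polynomial in the coefficients of P, for any bound n on
    the degree. *)
Definition real_moment n k (P : {poly R}) : R :=
  \sum_(j < n) P^`()`_j * (P ^+ k.+1)`_j.+1 / k.+1%:R.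

(** P^k P' = (P^(k+1))' / (k+1), and the orthogonality of the powers of z pairs
    its coefficients with those of P'. *)
Lemma moment_real_poly n k (P : {poly R}) : (size P <= n.+1)%N ->
  moment k (map_poly (real_complex R) P) = (real_moment n k P)%:C.
Proof.
move=> sP; set PC := map_poly _ P.
have sP' : (size PC^`() <= n)%N.
  apply/leq_sizeP => j nj; rewrite coef_deriv nth_default ?mul0rn //.
  by rewrite size_map_poly (leq_trans sP).
have -> : moment k PC = (pi^-1)%:C *
    diskint (fun p => (PC ^+ k * PC^`()).[p.1 +i* p.2] * PC^`().[p.1 -i* p.2]).
  congr (_ * _); rewrite /cintegral /diskint.
  suff E p : PC.[p.1 +i* p.2] ^+ k * `|PC^`().[p.1 +i* p.2]| ^+ 2 =
     (PC ^+ k * PC^`()).[p.1 +i* p.2] * PC^`().[p.1 -i* p.2].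
    by congr (_ +i* _); apply: eq_Rintegral => p _; rewrite E.
  rewrite hornerM horner_exp sqr_normc mulrA; congr (_ * _).
  by rewrite /PC deriv_map horner_conj_real.
have E0 := diskint_poly (PC ^+ k * PC^`()) sP'.
rewrite [X in _ * X]E0 mulrA -rmorphM mulVf ?gt_eqF ?pi_gt0 // mul1r.
rewrite /real_moment rmorph_sum; apply: eq_bigr => j _ /=.
rewrite /PC deriv_map -rmorphXn -rmorphM /= !coef_map /= -rmorphM.
rewrite -(rmorph_nat (real_complex R)) -fmorphV -rmorphM; congr (_%:C).
rewrite [P ^+ k * _]mulrC.
have : (P ^+ k.+1)`_j.+1 * j.+1%:R = (P^`() * P ^+ k)`_j * k.+1%:R.
  by rewrite !mulr_natr -coef_deriv deriv_exp coefMn.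
move: (_`_j.+1) (_`_j) (P^`()`_j) => x y z E.
have nz i : (i.+1%:R : R) != 0 by rewrite pnatr_eq0.
have -> : y = x * j.+1%:R / k.+1%:R by rewrite E mulfK.
have e0 : k.+1%:R != 0 :> R := nz k; have e1 : j.+1%:R != 0 :> R := nz j.
move: e0 e1 E; move: (k.+1%:R : R) (j.+1%:R : R) => u v u0 v0 E.
by field; rewrite u0 v0.
Qed.

(** Differentiability is taken coefficient by coefficient, polynomials carrying
    no topology. *)
Definition polyderive (H : R -> {poly R}) (x : R) (d : {poly R}) :=
  forall i, is_derive x 1 (fun h => (H h)`_i) d`_i.

Lemma polyderiveM F G x f g : polyderive F x f -> polyderive G x g ->
  polyderive (fun h => F h * G h) x (f * G x + F x * g).
Proof.
move=> dF dG i.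
have -> : (fun h => (F h * G h)`_i) =
    \sum_(j < i.+1) ((fun h => (F h)`_j) * (fun h => (G h)`_(i - j))).
  by apply/funext => h; rewrite coefM fct_sumE.
have d (j : 'I_i.+1) := is_deriveM (dF j) (dG (i - j)%N).
apply: (is_derive_eq (@is_derive_sum _ _ _ _ _ _ _ _ d));
  rewrite coefD !coefM -big_split; apply: eq_bigr => j _ /=.
by rewrite /GRing.scale /=; ring.
Qed.

Lemma polyderiveX F x f k : polyderive F x f ->
  polyderive (fun h => F h ^+ k) x (f * F x ^+ k.-1 *+ k).
Proof.
move=> dF; elim: k => [|k IH] i.
  by rewrite mulr0n coef0; exact: (is_derive_cst (1 : {poly R})`_i x 1).
have := polyderiveM dF IH i; congr is_derive; first by apply/funext => h; rewrite exprS.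
congr (_`_i); case: k {IH} => [|k]; first by rewrite mulr0n mulr0 addr0.
by rewrite /= mulrnAr mulrCA -exprS [in RHS]mulrS.
Qed.

Lemma polyderive_deriv F x f : polyderive F x f ->
  polyderive (fun h => (F h)^`()) x f^`().
Proof.
move=> dF i; rewrite coef_deriv -mulr_natl.
have := is_deriveZ (i.+1%:R : R) (dF i.+1); congr is_derive.
by apply/funext => h; rewrite coef_deriv -[RHS]mulr_natl.
Qed.

Lemma real_moment_derive n k F x f : polyderive F x f ->
  is_derive x 1 (fun h => real_moment n k (F h))
   (\sum_(j < n) (f^`()`_j * (F x ^+ k.+1)`_j.+1 / k.+1%:R +
     (F x)^`()`_j * (f * F x ^+ k)`_j.+1)).
Proof.
move=> dF.
have d1 := polyderive_deriv dF; have d2 := polyderiveX k.+1 dF.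
have -> : (fun h => real_moment n k (F h)) =
    \sum_(j < n) (k.+1%:R^-1 *: ((fun h => (F h)^`()`_j) * (fun h => (F h
      ^+ k.+1)`_j.+1))).
  apply/funext => h; rewrite fct_sumE; apply: eq_bigr => j _.
  by rewrite mulrC.
have d (j : 'I_n) := is_deriveZ (k.+1%:R^-1 : R) (is_deriveM (d1 j) (d2 j.+1)).
apply: (is_derive_eq (@is_derive_sum _ _ _ _ _ _ _ _ d)); apply: eq_bigr => j _ /=.
rewrite coefMn -mulr_natl /GRing.scale /=.
have nz : (k.+1%:R : R) != 0 by rewrite pnatr_eq0.
by field.
Qed.

(** The first half of the derivative, where P' varies, is i.+1 times a
    coefficient of P^(k+1) over k.+1, hence a coefficient of P^k P'; the
    second half, where P^(k+1) varies, pairs P' with the shifted coefficients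
    of P^k. *)
Lemma real_moment_derive_Xn n k (P : {poly R}) (i : nat) : (i < n)%N ->
  (size P <= n.+1)%N ->
  is_derive (0 : R) 1 (fun h => real_moment n k (P + h *: 'X^(i.+1)))
   (\sum_(m < n) (P ^+ k)`_m * (P^`()`_(i + m) + ('X^m * P^`())`_i)).
Proof.
move=> lin sP.
have dF : polyderive (fun h => P + h *: 'X^(i.+1)) 0 'X^(i.+1).
  move=> j.
  have -> : (fun h => (P + h *: 'X^(i.+1))`_j) = cst P`_j +
    id * cst ('X^(i.+1) : {poly R})`_j.
    by apply/funext => h; rewrite coefD coefZ.
  have := is_deriveD (is_derive_cst P`_j (0 : R) 1)
    (is_deriveM (is_derive_id (0 : R) 1) (is_derive_cst ('X^(i.+1) :
      {poly R})`_j (0 : R) 1)).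
  by congr is_derive; rewrite /GRing.scale /= add0r mul0r add0r mulr1.
have := real_moment_derive n k dF; rewrite scale0r addr0; congr is_derive.
rewrite big_split; under [RHS]eq_bigr => m _ do rewrite mulrDr.
rewrite [RHS]big_split /= [RHS]addrC; congr (_ + _).
  have -> : \sum_(j < n) ('X^(i.+1))^`()`_j * (P ^+ k.+1)`_j.+1 / k.+1%:R
    = (P ^+ k * P^`())`_i.
    rewrite (bigD1 (Ordinal lin)) //= big1 => [|j]; last first.
      rewrite -val_eqE /= => /negPf ji.
      by rewrite derivXn coefMn coefXn /= ji mul0rn !mul0r.
    rewrite addr0 derivXn coefMn coefXn eqxx /= mulr_natl -coef_deriv.
    rewrite deriv_exp coefMn /= mulrC -[X in _ * X]mulr_natr mulrCA mulVf
      ?mulr1 ?pnatr_eq0 //.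
    by rewrite mulrC.
  rewrite coefM (big_ord_widen n (fun m => (P ^+ k)`_m * P^`()`_(i - m))) // big_mkcond.
  apply: eq_bigr => m _; rewrite coefXnM ltnS.
  by case: leqP => // _; rewrite mulr0.
have dP m : (n <= m)%N -> P^`()`_m = 0.
  by move=> nm; rewrite coef_deriv nth_default ?mul0rn // (leq_trans sP).
rewrite -(big_mkord xpredT (fun j => P^`()`_j * ('X^(i.+1) * P ^+ k)`_j.+1)).
rewrite -(big_mkord xpredT (fun m => (P ^+ k)`_m * P^`()`_(i + m))).
rewrite (@big_cat_nat _ _ _ i) //=; last exact: ltnW.
rewrite big_nat_cond big1 ?add0r => [|j]; last first.
  by rewrite andbT => /andP[_ ji]; rewrite coefXnM ltnS ji mulr0.
rewrite [RHS](@big_cat_nat _ _ _ (n - i)) //= ?leq_subr //.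
rewrite [X in _ = _ + X]big_nat_cond [X in _ = _ + X]big1 ?addr0 => [|m]; last first.
  by rewrite andbT => /andP[nm _]; rewrite dP ?mulr0 //; lia.
rewrite -{1}(add0n i) big_addn; apply: eq_bigr => m _.
by rewrite coefXnM -addnS ltnNge leq_addl /= addnK addnC mulrC.
Qed.

Lemma derive_line n (g : 'rV[R]_n -> R) (a v : 'rV[R]_n) d :
  is_derive (0 : R) 1 (fun h => g (h *: v + a)) d -> 'D_v g a = d.
Proof.
move=> [_ <-]; rewrite /derive; do 2 f_equal; apply/funext => h /=.
by rewrite addr0 scale0r add0r /GRing.scale /= mulr1.
Qed.

End Mom.

(** * The Jacobian *)

Lemma size_poly_of_coefs (R : realType) n (b : 'rV[R]_n) :
  (size (poly_of_coefs b) <= n.+1)%N.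
Proof.
apply: (leq_trans (size_sum _ _ _)); apply/bigmax_leqP => j _.
by apply: (leq_trans (size_scale_leq _ _)); rewrite size_polyXn ltnS.
Qed.

Lemma poly_of_coefs_line (R : realType) n (a : 'rV[R]_n) (j : 'I_n) h :
  poly_of_coefs (h *: delta_mx 0 j + a) = poly_of_coefs a + h *: 'X^(j.+1).
Proof.
rewrite /poly_of_coefs [RHS]addrC.
under eq_bigr => i _ do rewrite !mxE scalerDl.
rewrite big_split (bigD1 j) //= big1 => [|i /negPf ij].
  by rewrite !eqxx mulr1 addr0.
by rewrite ij ?andbF mulr0 scale0r.
Qed.

Lemma cpartial_moment (R : realType) n (a : 'rV[R]_n) (k j : 'I_n) :
  cpartial (fun b => moment_map b 0 k) j a =
  (\sum_(m < n) (poly_of_coefs a ^+ k)`_m *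
     ((poly_of_coefs a)^`()`_(j + m) + ('X^m * (poly_of_coefs a)^`())`_j))%:C.
Proof.
have mE (b : 'rV[R]_n) : moment_map b 0 k = (real_moment n k (poly_of_coefs b))%:C.
  by rewrite mxE (moment_real_poly _ (size_poly_of_coefs b)).
rewrite /cpartial; congr (_ +i* _).
  apply: derive_line; have := real_moment_derive_Xn k (ltn_ord j)
    (size_poly_of_coefs a).
  by congr is_derive; apply/funext => h; rewrite mE poly_of_coefs_line.
rewrite (_ : (fun b => _) = cst 0); first exact: derive_cst.
by apply/funext => b; rewrite mE.
Qed.

(** P^k starts at degree k, with coefficient P`_1^k. *)
Lemma det_coef_mx_pow (R : fieldType) N (P : {poly R}) : P`_0 = 0 ->
  \det (coef_mx N (fun k => P ^+ k)) = P`_1 ^+ 'C(N.+1, 2).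
Proof.
move=> P0; have [Q ->] : exists Q, P = 'X * Q.
  have : root P 0 by rewrite /root horner_coef0 P0.
  by move/factor_theorem => [Q ->]; exists Q; rewrite polyC0 subr0 mulrC.
rewrite -det_tr det_trig; last first.
  by apply/is_trig_mxP => i j ij; rewrite !mxE exprMn coefXnM ij.
rewrite -['C(_, _)]triangular_sum big_mkord -prodrXr; apply: eq_bigr => i _.
by rewrite !mxE exprMn coefXnM ltnn subnn -horner_coef0 horner_exp horner_coef0 coefXM.
Qed.

Theorem corollary3 (R : realType) (n : nat) (a : 'rV[R]_n) :
  (2 <= n)%N ->
  let P := poly_of_coefs a in
  0 < P`_1 -> P`_n != 0 ->
  moment_jacobian a =
    ((2 : R) ^ (- ((n%:Z * (n%:Z - 3)) %/ 2)%Z)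
     * P`_1 ^+ ((n * (n - 1)) %/ 2)%N
     * P^`().[1] * P^`().[-1]
     * hurwitz_det (size P^`()).-1 (mobius P^`()))%:C.
Proof.
case: n a => [//|N] a N0 P _ Pn.
have sP : size P = N.+2.
  apply/eqP; rewrite eqn_leq size_poly_of_coefs ltnNge.
  apply/negP => /leq_sizeP/(_ _ (leqnn _)).
  exact/eqP.
have sr : size P^`() = N.+1.
  apply/eqP; rewrite eqn_leq; apply/andP; split.
    by apply/leq_sizeP => j nj; rewrite coef_deriv nth_default ?mul0rn // sP.
  rewrite ltnNge; apply/negP => /leq_sizeP/(_ _ (leqnn _)); rewrite coef_deriv.
  by apply/eqP; rewrite -mulr_natr mulf_neq0 // pnatr_eq0.
have P0 : P`_0 = 0.
  by rewrite coef_sum big1 // => i _; rewrite coefZ coefXn mulr0.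
have -> : moment_jacobian a =
    (\det (coef_mx N (fun k => P ^+ k) *m fold_mx N P^`()))%:C.
  rewrite -det_map_mx; congr (\det _); apply/matrixP => k j.
  rewrite mxE cpartial_moment !mxE; congr (_%:C).
  by apply: eq_bigr => m _; rewrite !mxE.
congr (_%:C); rewrite det_mulmx det_coef_mx_pow //.
have two0 : (2 : R) != 0 by rewrite pnatr_eq0.
have := det_fold_mobius two0 (r := P^`()); rewrite sr => /(_ N0) /=.
move: (hurwitz_det _ _) => Delta; move: (\det _) => W E.
set e := (_ %/ 2)%Z.
have bE : ((N.+1 * (N.+1 - 1)) %/ 2)%N = 'C(N.+1, 2) by rewrite bin2 divn2 subn1.
have e2 : (2 : R) ^ (- e) * 2 ^+ 'C(N.+1, 2) = 2 ^+ N.+1.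
  have eE : e = ('C(N.+1, 2))%:Z - N.+1%:Z.
    have : ('C(N.+1, 2) * 2 = N.+1 * N)%N.
      by rewrite bin2 /= muln2 even_halfK // oddM /= andNb.
    rewrite /e => H.
    have -> : N.+1%:Z * (N.+1%:Z - 3) = (('C(N.+1, 2))%:Z - N.+1%:Z) * 2 by lia.
    by rewrite mulzK.
  by rewrite [2 ^+ 'C(_, _)]exprnP -exprzDr ?unitfE // eE opprB addrNK.
rewrite bE; apply: (mulIf (expf_neq0 'C(N.+1, 2) two0)).
rewrite -[LHS]mulrA E -e2; ring.
Qed.
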